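(* Let $q\ge1$, let $V\subset\mathbb{N}^q$ be a set all of whose elements $v$ satisfy $\|v\|_1=2$, and fix an intensity vector $\lambda\in(0,\infty)^q$. (i) If there exists a deficient set $S\subset[q]$, then $\lambda\notin\operatorname{cone}(V)$ (and there is no translation-invariant $V$-matching scheme for independent homogeneous Poisson processes $\Pi_1,\dots,\Pi_q$ on $\mathbb{R}^d$ of intensities $\lambda_1,\dots,\lambda_q$). (ii) If there is no deficient set, but there is a critical $S\subset[q]$, then $\lambda\in\partial\operatorname{cone}(V)$. (iii) If every non-empty subset $S\subset[q]$ is excessive or has $N(S)=S$, then $\lambda\in(\operatorname{cone}(V))^\circ$.
   Context: $\mathbb{N}=\{0,1,2,\dots\}$, $[q]=\{1,\dots,q\}$, $e_i$ is the $i$th unit vector. $\operatorname{cone}(V)=\{\sum_i a^iv^i:v^i\in V,\ a^i\in[0,\infty)\}\subset\mathbb{R}^q$; $\partial$ and ${}^\circ$ denote boundary and interior in $\mathbb{R}^q$. Define a graph on vertex set $[q]$, possibly with self-loops, by $i\sim j$ if and only if $e_i+e_j\in V$ (with $i=j$ allowed). For $S\subset[q]$ let $N(S)=\{x\in[q]:\exists y\in S\text{ with }x\sim y\}$ and $\lambda(S)=\sum_{i\in S}\lambda_i$. A non-empty set $S\subset[q]$ is called deficient if $\lambda(N(S))<\lambda(S)$; critical if $\lambda(N(S))=\lambda(S)$ and $S\ne N(S)$; excessive if $\lambda(N(S))>\lambda(S)$. A $V$-matching scheme for $\Pi_1,\dots,\Pi_q$ is a simple point process $\mathcal{M}$ on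 unordered finite subsets of $\mathbb{R}^d$ (defined jointly with the $\Pi_i$, not necessarily a function of them) such that almost surely its support is a partition of the set of all points of $\Pi_1,\dots,\Pi_q$ into finite sets $F$, each of type $(\#(F\cap[\Pi_i]))_{i=1}^q\in V$, where $[\Pi_i]$ is the support of $\Pi_i$. It is translation-invariant if the joint law of $(\mathcal{M},\Pi_1,\dots,\Pi_q)$ is invariant under the diagonal action of translations of $\mathbb{R}^d$. *)

(* Defs.v *)
From HB Require Import structures.
From mathcomp Require Import all_boot all_order all_algebra finmap.
From mathcomp Require Import all_classical all_reals all_analysis.

Set Implicit Arguments.
Unset Strict Implicit.
Unset Printing Implicit Defensive.

Import Order.TTheory GRing.Theory Num.Theory.
Import numFieldNormedType.Exports.

Local Open Scope classical_set_scope.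
Local Open Scope ring_scope.
Local Open Scope card_scope.

Section Cone.
Variables (R : realType) (q : nat) (V : set 'rV[nat]_q).

Definition cone : set 'rV[R]_q :=
  [set x | exists (n : nat) (v : 'I_n -> 'rV[nat]_q) (a : 'I_n -> R),
     (forall k, V (v k) /\ 0 <= a k) /\
     x = \sum_(k < n) a k *: map_mx (fun m : nat => m%:R) (v k)].

End Cone.
Arguments cone R {q} V.

Definition boundary (T : topologicalType) (A : set T) : set T :=
  closure A `\` interior A.

Section Graph.
Variables (R : realType) (q : nat) (V : set 'rV[nat]_q) (lam : 'rV[R]_q).

Definition unit_vec (i : 'I_q) : 'rV[nat]_q := delta_mx 0 i.

(* Self-loops are allowed: [adj i i] says that 2 e_i is in V. *)
Definition adj (i j : 'I_q) : Prop := V (unit_vec i + unit_vec j).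

Definition nbh (S : {set 'I_q}) : {set 'I_q} :=
  [set x | `[< exists2 y, y \in S & adj x y >]]%SET.

Definition weight (S : {set 'I_q}) : R := \sum_(i in S) lam ord0 i.

Definition deficient (S : {set 'I_q}) : Prop :=
  S != finset.set0 /\ weight (nbh S) < weight S.

Definition critical (S : {set 'I_q}) : Prop :=
  [/\ S != finset.set0, weight (nbh S) = weight S & S <> nbh S].

Definition excessive (S : {set 'I_q}) : Prop :=
  S != finset.set0 /\ weight (nbh S) > weight S.

End Graph.

(* A simple point process is represented by its support, a random set X; the
   number of points in B is n iff X `&` B #= `I_n. *)
Section PointProcess.
Variable T : Type.

(* The sigma-algebra on configurations generated by the numbers of points in
   the sets of the system G. *)
Definition config_events (G : set_system T) : set_system (set T) :=
  <<s [set C | exists2 B, G B &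
         exists n : nat, C = [set X : set T | X `&` B #= `I_n]] >>.

(* G is the sigma-algebra of T and K its class of bounded sets. *)
Definition simple_point_process (G K : set_system T)
    (disp : measure_display) (Omega : measurableType disp)
    (X : Omega -> set T) : Prop :=
  (forall w B, K B -> finite_set (X w `&` B)) /\
  (forall C, config_events G C -> measurable (X @^-1` C)).

End PointProcess.

Section Euclidean.
Variables (R : realType) (d : nat).

Definition borel : set_system 'rV[R]_d := <<s open >>.

Definition shift (t : 'rV[R]_d) (A : set 'rV[R]_d) : set 'rV[R]_d :=
  [set x + t | x in A].

(* An event on finite sets is one on configurations: the sigma-algebra is
   generated by the maps F |-> #(F `&` B), B Borel. *)
Definition fset_events : set_system {fset 'rV[R]_d} :=
  preimage_set_system setT (fun F : {fset 'rV[R]_d} => [set` F])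
    (config_events borel).

(* Local finiteness on the space of finite sets: only finitely many members of
   the process lie inside a given bounded set. *)
Definition fset_bounded : set_system {fset 'rV[R]_d} :=
  [set D | exists2 B : set 'rV[R]_d, bounded_set B &
             forall F, D F -> [set` F] `<=` B].

Definition fset_shift (t : 'rV[R]_d) (M : set {fset 'rV[R]_d}) :
    set {fset 'rV[R]_d} :=
  [set [fset (x + t)%R | x in F]%fset | F in M].

End Euclidean.

(* Lebesgue measure of a Borel set of R^d, as the d-fold product of the Lebesgue
   measure of R, obtained by integrating the volumes of the sections. *)
Fixpoint volume (R : realType) (d : nat) : set 'rV[R]_d -> \bar R :=
  match d return set 'rV[R]_d -> \bar R with
  | 0 => fun A => (\1_A 0)%:E
  | d'.+1 => fun A =>
      (\int[@lebesgue_measure R]_x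
         volume [set y : 'rV[R]_d' | A (row_mx (x : R)%:M y)])%E
  end.

(* Not [poisson_pmf], which is 1 for every k at r = 0; here r = 0 gives the unit
   mass at k = 0. *)
Definition poisson_weight (R : realType) (r : R) (k : nat) : R :=
  expR (- r) * r ^+ k / k`!%:R.

Section Matching.
Variables (R : realType) (q d : nat).
Variables (disp : measure_display) (Omega : measurableType disp).
Variable P : probability Omega R.

Definition poisson_process (lam : R) (X : Omega -> set 'rV[R]_d) : Prop :=
  simple_point_process (@borel R d) bounded_set X /\
  forall (n : nat) (B : 'I_n -> set 'rV[R]_d) (k : 'I_n -> nat),
    (forall j, borel (B j) /\ bounded_set (B j)) -> trivIset setT B ->
    P [set w | forall j, X w `&` B j #= `I_(k j)] =
    (\prod_(j < n) poisson_weight (lam * fine (volume (B j))) (k j))%:E.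

Definition independent_processes (Pi : 'I_q -> Omega -> set 'rV[R]_d) : Prop :=
  forall C : 'I_q -> set (set 'rV[R]_d),
    (forall i, config_events (@borel R d) (C i)) ->
    P (\bigcap_i (Pi i @^-1` C i)) = (\prod_(i < q) P (Pi i @^-1` C i))%E.

Definition independent_poisson (lam : 'rV[R]_q)
    (Pi : 'I_q -> Omega -> set 'rV[R]_d) : Prop :=
  (forall i, poisson_process (lam ord0 i) (Pi i)) /\ independent_processes Pi.

Definition matching_scheme (V : set 'rV[nat]_q)
    (Pi : 'I_q -> Omega -> set 'rV[R]_d)
    (M : Omega -> set {fset 'rV[R]_d}) : Prop :=
  simple_point_process (@fset_events R d) (@fset_bounded R d) M /\
  {ae P, forall w,
     partition (M w) (fun F : {fset 'rV[R]_d} => [set` F])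
       (\bigcup_i Pi i w) /\
     forall F, M w F ->
       exists2 v, V v & forall i, [set` F] `&` Pi i w #= `I_(v ord0 i)}.

Definition joint_events :
    set_system (set {fset 'rV[R]_d} * ('I_q -> set 'rV[R]_d)) :=
  <<s [set D |
    (exists2 C, config_events (@fset_events R d) C &
       D = [set c | C c.1]) \/
    (exists i, exists2 C, config_events (@borel R d) C &
       D = [set c | C (c.2 i)])] >>.

Definition translation_invariant (Pi : 'I_q -> Omega -> set 'rV[R]_d)
    (M : Omega -> set {fset 'rV[R]_d}) : Prop :=
  forall (t : 'rV[R]_d) D, joint_events D ->
    P [set w | D (fset_shift t (M w), fun i => shift t (Pi i w))] =
    P [set w | D (M w, fun i => Pi i w)].

End Matching.

(* Main.v *)
Require Import Defs.
From mathcomp Require Import all_boot all_order all_algebra finmap.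
From mathcomp Require Import lra.
From mathcomp Require Import all_classical all_reals all_analysis.
From mathcomp Require Import measurable_realfun.
Import Order.TTheory GRing.Theory Num.Theory.
Import numFieldNormedType.Exports.
Local Open Scope classical_set_scope.
Local Open Scope ring_scope.

Set Implicit Arguments.
Unset Strict Implicit.
Unset Printing Implicit Defensive.

(** The cone.  An element of [V] is [e_i + e_j] with [i ~ j], and it has at
    least as much mass on [N(S)] as on [S], because [i] in [S] forces [j] in
    [N(S)] and conversely.  So every vector of the cone satisfies
    [x(S) <= x(N(S))] ([cone_weight_le]).  Conversely, let [x >= 0] satisfy all
    these inequalities.  They are Hall's condition for transporting the supply
    [x] to the demand [x] along the edges [i ~ j]; the real-valued form of
    Hall's theorem ([hall_transportable]) gives a plan [w], and [x] is the sum
    of the [w_ij / 2 * (e_i + e_j)] ([weight_le_cone]).  Hence the cone is cut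
    out of the orthant by finitely many weak linear inequalities.  At [lam], in
    the open orthant, an inequality is stable under perturbation when it is
    strict or when [N(S) = S], which gives the interior point; a critical [S]
    has an [i] in [S] but not in [N(S)], and increasing [lam_i] leaves the cone.

    The matching.  Suppose that a translation-invariant scheme exists.  In a
    cube of side [m], each point of a class in [S] lies in a block which has at
    least as many points in [N(S)] as in [S]; the only blocks for which this
    does not compare the number of points of [S] in the cube with the number of
    points of [N(S)] in the cube enlarged by [r] are those that meet the cube
    and leave the enlarged one ([counting_matched]).  Cover the cube by
    [(m+1)^d] unit cubes: by invariance each of them accounts in the mean for
    at most [g(r)] such blocks, where [g(r)] is the mean number of blocks that
    meet the unit cube and leave its enlargement by [r].  Thus
      [lam(S) m^d <= lam(N(S)) (m+1+2r)^d + 2 (m+1)^d g(r)]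
    ([weight_volume_le]).  Blocks are finite, so [g(r)] tends to [0] by
    dominated convergence ([mean_long_blocks_cvg0]).  Letting [m], then [r], go
    to infinity yields [lam(S) <= lam(N(S))], so that no set is deficient.
    The means taken are those of numbers of blocks and of numbers of points of one
    class, never of the two jointly, so the invariance of the law of the matching
    is enough. *)

(** * Transport along the edges of a bipartite graph *)

Section Transport.
Variables (R : realFieldType) (I J : finType).
Implicit Types (E : {set I * J}) (S : {set I}) (a : I -> R) (b : J -> R).

Definition targets E S : {set J} := [set j | [exists i in S, (i, j) \in E]]%SET.

Definition hall E a b :=
  forall S, \sum_(i in S) a i <= \sum_(j in targets E S) b j.

Definition transportable E a b := exists w : I -> J -> R,
  [/\ forall i j, 0 <= w i j, forall i j, (i, j) \notin E -> w i j = 0,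
      forall i, \sum_j w i j = a i & forall j, \sum_i w i j <= b j].

Lemma targetsP E S j :
  reflect (exists2 i, i \in S & (i, j) \in E) (j \in targets E S).
Proof.
rewrite inE; apply: (iffP existsP) => [[i /andP[]]|[i iS ij]]; first by exists i.
by exists i; rewrite iS.
Qed.

Lemma targets_sub E E' S S' :
  (forall i j, i \in S -> (i, j) \in E -> i \in S' /\ (i, j) \in E') ->
  targets E S \subset targets E' S'.
Proof.
move=> h; apply/fintype.subsetP => j /targetsP[i iS ij]; apply/targetsP.
by have [? ?] := h _ _ iS ij; exists i.
Qed.

Lemma sum_subset_le (K : finType) (A B : {set K}) (f : K -> R) :
  (forall k, 0 <= f k) -> A \subset B ->
  \sum_(k in A) f k <= \sum_(k in B) f k.
Proof.
move=> f0 AB; rewrite [leRHS](big_setID A)/= (finset.setIidPr AB) lerDl.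
exact: sumr_ge0.
Qed.

Lemma sum_restrict (K : finType) (A B : {set K}) (f : K -> R) :
  \sum_(k in A) (if k \in B then f k else 0) = \sum_(k in A :&: B) f k.
Proof. by rewrite -big_mkcondr; apply: eq_bigl => k; rewrite inE. Qed.

Lemma sum_point (K : finType) (A : {set K}) (k0 : K) (t : R) :
  \sum_(k in A) (if k == k0 then t else 0) = if k0 \in A then t else 0.
Proof.
rewrite -big_mkcondr/=; case: ifPn => k0A.
  by rewrite (big_pred1 k0) // => k /=; rewrite andbC; case: eqVneq => // ->.
by rewrite big_pred0 // => k; rewrite andbC; case: eqVneq => // ->; apply/negbTE.
Qed.

(** One step of a greedy construction: ship [t] along an edge and leave the rest
    to a plan on fewer edges. *)
Lemma transportable_push E E' a b i0 j0 t :
  E' \subset E -> (i0, j0) \in E -> 0 <= t ->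
  transportable E' (fun i => a i - (if i == i0 then t else 0))
                   (fun j => b j - (if j == j0 then t else 0)) ->
  transportable E a b.
Proof.
move=> sE ij t0 [w [w0 wE wa wb]].
have sumT (K : finType) (k0 : K) : \sum_k (if k == k0 then t else 0) = t.
  by rewrite -big_mkcond big_pred1_eq.
exists (fun i j => w i j + (if (i == i0) && (j == j0) then t else 0)); split.
- by move=> i j; rewrite addr_ge0//; case: ifP.
- move=> i j nE; rewrite wE ?add0r; last first.
    by apply: contra nE; apply/fintype.subsetP.
  by case: ifP => // /andP[/eqP ei /eqP ej]; rewrite ei ej ij in nE.
- move=> i; rewrite big_split/= wa.
  by case: eqP => /= _; rewrite ?sumT ?subrK// big1 ?addr0// subr0.
- move=> j; rewrite big_split/= -lerBrDr; apply: le_trans (wb j) _.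
  rewrite lerD2l lerN2; case: (j == j0); last first.
    by under eq_bigr do rewrite andbF; rewrite big1.
  by under eq_bigr do rewrite andbT; rewrite sumT.
Qed.

(** Hall's theorem with real weights (Gale's supply-demand theorem), by induction
    on the number of edges, as in the classical proof of the marriage theorem.
    Along an edge [(i0, j0)] ship the largest [t] that preserves Hall's condition.
    Then either [i0] has nothing left, or [j0] is full, and its edges may be
    deleted; or some [S0] that misses [i0] but has [j0] among its targets has
    become tight, and the problem splits into the edges leaving [S0] and those
    between the complements of [S0] and of its targets, neither of which contains
    [(i0, j0)]. *)
Lemma hall_transportable E a b :
  (forall i, 0 <= a i) -> (forall j, 0 <= b j) -> hall E a b ->
  transportable E a b.
Proof.
have [n] := ubnP #|E|; elim: n => // n IH in E a b *; rewrite ltnS => En a0 b0 H.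
have [E0|[[i0 j0] ij]] := set_0Vmem E.
  exists (fun _ _ => 0); split=> // [i|j]; last by rewrite big1.
  rewrite big1//; apply/esym/eqP; rewrite eq_le a0 andbT.
  have := H [set i]%SET; rewrite big_set1 (_ : targets _ _ = finset.set0) ?big_set0//.
  apply/setP => j; rewrite [RHS]inE; apply/negbTE/negP => /targetsP[i' _].
  by rewrite E0 inE.
pose slack S := \sum_(j in targets E S) b j - \sum_(i in S) a i.
pose tight S := (i0 \notin S) && (j0 \in targets E S).
pose t := \big[Num.min/Num.min (a i0) (b j0)]_(S | tight S) slack S.
have tle : t <= Num.min (a i0) (b j0) by apply: bigmin_le_id.
have ta : t <= a i0 by move: tle; rewrite le_min => /andP[].
have tb : t <= b j0 by move: tle; rewrite le_min => /andP[].
have tS S : tight S -> t <= slack S by move=> tS; apply: bigmin_le_cond.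
have t0 : 0 <= t.
  apply/bigmin_geP; split; first by rewrite le_min a0 b0.
  by move=> S _; rewrite subr_ge0.
have tcases : [\/ t = a i0, t = b j0 | exists2 S, tight S & t = slack S].
  rewrite /t; elim/big_ind: _ => [|x y hx hy|S HS]; last by constructor 3; exists S.
    by case: (leP (a i0) (b j0)) => _; [constructor 1|constructor 2].
  by case: (leP x y).
pose a' i := a i - (if i == i0 then t else 0).
pose b' j := b j - (if j == j0 then t else 0).
have a'0 i : 0 <= a' i by rewrite /a'; case: eqP => [->|_]; rewrite subr_ge0.
have b'0 j : 0 <= b' j by rewrite /b'; case: eqP => [->|_]; rewrite subr_ge0.
have a'S S : \sum_(i in S) a' i = \sum_(i in S) a i - (if i0 \in S then t else 0).
  by rewrite big_split/= sumrN sum_point.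
have b'S (T : {set J}) : \sum_(j in T) b' j = \sum_(j in T) b j - (if j0 \in T then t else 0).
  by rewrite big_split/= sumrN sum_point.
(* A set containing [i0] loses [t] on both sides; for the others [t] is at most
   the slack. *)
have H' : hall E a' b'.
  move=> S; rewrite a'S b'S; have HS := H S.
  case: ifPn => iS.
    rewrite ifT ?lerD2r//.
    by apply/targetsP; exists i0.
  case: ifPn => jS; last by rewrite lerD2r.
  by rewrite subr0 lerBrDl -lerBrDr; apply: tS; rewrite /tight iS.
have lt_card E' : E' \subset E -> (i0, j0) \notin E' -> (#|E'| < n)%N.
  move=> sE nE; apply: leq_trans En; apply: proper_card.
  by apply/properP; split=> //; exists (i0, j0).
case: tcases => [ti|tj|[S0 /andP[iS0 jS0] tS0]].
- have sE : [set p in E | p.1 != i0]%SET \subset E.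
    by apply/fintype.subsetP => p; rewrite inE => /andP[].
  apply: (transportable_push sE ij t0); apply: IH => //.
    by apply: lt_card => //; rewrite inE eqxx andbF.
  move=> S; apply: le_trans (_ : \sum_(i in S :\ i0) a' i <= _).
    have [iS|iS] := boolP (i0 \in S).
      rewrite [leLHS](big_setD1 i0)//= [X in X + _](_ : _ = 0) ?add0r//.
      by rewrite eqxx ti subrr.
    rewrite le_eqVlt; apply/orP; left; apply/eqP; apply: eq_bigl => i.
    by rewrite in_setD1; case: eqP => // ->; rewrite (negbTE iS).
  apply: le_trans (H' _) _; apply: sum_subset_le => //; apply: targets_sub => i j.
  by rewrite !inE => /andP[ii iS] ->.
- have sE : [set p in E | p.2 != j0]%SET \subset E.
    by apply/fintype.subsetP => p; rewrite inE => /andP[].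
  apply: (transportable_push sE ij t0); apply: IH => //.
    by apply: lt_card => //; rewrite inE eqxx andbF.
  move=> S; apply: le_trans (H' S) _.
  apply: le_trans (_ : \sum_(j in targets E S :\ j0) b' j <= _).
    have [jS|jS] := boolP (j0 \in targets E S).
      rewrite [leLHS](big_setD1 j0)//= [X in X + _](_ : _ = 0) ?add0r//.
      by rewrite /b' eqxx tj subrr.
    rewrite le_eqVlt; apply/orP; left; apply/eqP; apply: eq_bigl => j.
    by rewrite in_setD1; case: eqP => // ->; rewrite (negbTE jS).
  apply: sum_subset_le => //; apply/fintype.subsetP => j.
  rewrite in_setD1 => /andP[jj /targetsP[i iS ijE]]; apply/targetsP; exists i => //.
  by rewrite inE ijE.
- pose E1 := [set p in E | p.1 \in S0]%SET.
  pose E2 := [set p in E | (p.1 \notin S0) && (p.2 \notin targets E S0)]%SET.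
  have sE1 : E1 \subset E by apply/fintype.subsetP => p; rewrite inE => /andP[].
  have sE2 : E2 \subset E by apply/fintype.subsetP => p; rewrite inE => /andP[].
  have tight0 : \sum_(i in S0) a' i = \sum_(j in targets E S0) b' j.
    by rewrite a'S b'S (negbTE iS0) jS0 subr0 tS0 /slack opprB addrC subrK.
  have [w1 [w10 w1E w1a w1b]] : transportable E1
      (fun i => if i \in S0 then a' i else 0)
      (fun j => if j \in targets E S0 then b' j else 0).
    apply: IH => [|i|j|S]; [|by case: ifP|by case: ifP|].
      by apply: lt_card => //; rewrite inE (negbTE iS0) andbF.
    rewrite !sum_restrict; apply: le_trans (H' _) _.
    apply: sum_subset_le => //; rewrite finset.subsetI; apply/andP; split.
      by apply: targets_sub => i j; rewrite !inE => /andP[-> ->] ->.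
    by apply: targets_sub => i j; rewrite !inE => /andP[_ ->] ->.
  have [w2 [w20 w2E w2a w2b]] : transportable E2
      (fun i => if i \in ~: S0 then a' i else 0)
      (fun j => if j \in ~: targets E S0 then b' j else 0).
    apply: IH => [|i|j|S]; [|by case: ifP|by case: ifP|].
      by apply: lt_card => //; rewrite inE jS0 !andbF.
    rewrite !sum_restrict -finset.setDE.
    (* Hall's condition for [S0 :|: S], minus the equality for [S0]. *)
    rewrite -(lerD2l (\sum_(i in S0) a' i)).
    have -> : \sum_(i in S0) a' i + \sum_(i in S :\: S0) a' i = \sum_(i in S0 :|: S) a' i.
      rewrite [RHS](big_setID S0)/= finset.setUK; congr (_ + _).
      by apply: eq_bigl => i; rewrite !inE; case: (i \in S0).
    apply: le_trans (H' _) _.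
    rewrite [leLHS](big_setID (targets E S0))/= tight0; apply: lerD.
      by apply: sum_subset_le => //; exact: finset.subsetIr.
    apply: sum_subset_le => //; apply/fintype.subsetP => j.
    rewrite finset.in_setD finset.in_setI finset.in_setC => /andP[jS /targetsP[i iS ijE]].
    rewrite jS andbT; apply/targetsP; exists i.
      move: iS; rewrite inE => /orP[iS|//].
      by case/negP: jS; apply/targetsP; exists i.
    rewrite inE ijE/= jS andbT; apply: contra jS => iS'.
    by apply/targetsP; exists i.
  apply: (@transportable_push E E a b i0 j0 t) => //.
  exists (fun i j => w1 i j + w2 i j); split.
  + by move=> i j; rewrite addr_ge0.
  + move=> i j nE; rewrite w1E ?w2E ?addr0//.
      by apply: contra nE; apply/fintype.subsetP.
    by apply: contra nE; apply/fintype.subsetP.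
  + move=> i; rewrite big_split/= w1a w2a inE -/(a' i).
    by case: (i \in S0); rewrite ?addr0 ?add0r.
  + move=> j; rewrite big_split/=; apply: le_trans (lerD (w1b j) (w2b j)) _.
    by rewrite finset.in_setC; case: (j \in targets E S0); rewrite ?addr0 ?add0r.
Qed.

End Transport.

(** * The cone spanned by the edges of a graph *)

Section ConeGraph.
Variables (R : realType) (q : nat) (V : set 'rV[nat]_q).
Hypothesis V2 : forall v, V v -> (\sum_(i < q) v ord0 i)%N = 2%N.

Lemma adjC i j : adj V i j -> adj V j i.
Proof. by rewrite /adj addrC. Qed.

Lemma adj_nbh (S : {set 'I_q}) i j : adj V i j -> j \in S -> i \in nbh V S.
Proof. by move=> ij jS; rewrite inE; apply/asboolP; exists j. Qed.

Lemma sum_unit_vec (S : {set 'I_q}) i :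
  (\sum_(k in S) unit_vec i ord0 k = (i \in S))%N.
Proof.
under eq_bigr => k _ do rewrite mxE eqxx/=.
have [iS|iS] := boolP (i \in S); last first.
  by rewrite big1// => k kS; case: eqVneq => // ki; rewrite -ki kS in iS.
rewrite (bigD1 i)//= eqxx big1// => k /andP[_]; by case: eqVneq.
Qed.

Lemma vec1_unit (v : 'rV[nat]_q) :
  (\sum_(i < q) v ord0 i = 1)%N -> exists i, v = unit_vec i.
Proof.
move=> v1.
have [i vi] : exists i, v ord0 i != 0%N.
  apply/existsP; apply: contraT => /existsPn v0.
  by move: v1; rewrite big1// => i _; apply/eqP/negPn.
exists i; apply/rowP => k; rewrite mxE eqxx/=.
move: v1; rewrite (bigD1 i)//=; case vin : (v ord0 i) vi => [//|n] _.
rewrite addSn => -[] /eqP; rewrite addn_eq0 => /andP[/eqP n0 /eqP s0].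
rewrite n0 in vin; case: eqVneq => [->|ki]; first by rewrite vin.
by move/eqP: s0; rewrite sum_nat_eq0 => /forallP/(_ k); rewrite ki => /eqP.
Qed.

Lemma vec2_edge (v : 'rV[nat]_q) : V v ->
  exists i j, v = unit_vec i + unit_vec j /\ adj V i j.
Proof.
move=> Vv; have v2 := V2 Vv.
have [i vi] : exists i, v ord0 i != 0%N.
  apply/existsP; apply: contraT => /existsPn v0.
  by move: v2; rewrite big1// => i _; apply/eqP/negPn.
have ve : v = unit_vec i + \row_k (v ord0 k - unit_vec i ord0 k)%N.
  apply/rowP => k; rewrite !mxE eqxx/= [RHS]subnKC//.
  by case: eqVneq => // ->; rewrite lt0n.
have [j ej] : exists j, \row_k (v ord0 k - unit_vec i ord0 k)%N = unit_vec j.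
  apply: vec1_unit; move: v2; rewrite [in X in X -> _]ve.
  under eq_bigr do rewrite mxE; rewrite big_split/=.
  have := sum_unit_vec finset.setT i; rewrite inE.
  under eq_bigl do rewrite inE.
  by move=> ->; rewrite add1n => -[].
by exists i, j; rewrite -ej -ve; split=> //; rewrite /adj -ej -ve.
Qed.

(** The two unit vectors of [v] are exchanged: the one in [S] puts the other one
    in the neighbourhood of [S]. *)
Lemma sum_nbh_le (v : 'rV[nat]_q) (S : {set 'I_q}) : V v ->
  (\sum_(i in S) v ord0 i <= \sum_(i in nbh V S) v ord0 i)%N.
Proof.
move=> /vec2_edge[i [j [-> ij]]].
under eq_bigr do rewrite mxE; under [leqRHS]eq_bigr do rewrite mxE.
rewrite !big_split/= !sum_unit_vec addnC; apply: leq_add.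
  by case: (boolP (j \in S)) => // /(adj_nbh ij) ->.
by case: (boolP (i \in S)) => // /(adj_nbh (adjC ij)) ->.
Qed.

Lemma cone_weight_le (x : 'rV[R]_q) (S : {set 'I_q}) :
  cone R V x -> weight x S <= weight x (nbh V S).
Proof.
move=> [n [v [a [va ->]]]]; rewrite /weight.
under eq_bigr do rewrite summxE; under [leRHS]eq_bigr do rewrite summxE.
rewrite exchange_big/= [leRHS]exchange_big/=; apply: ler_sum => k _.
have [Vk ak] := va k.
under eq_bigr do rewrite !mxE; under [leRHS]eq_bigr do rewrite !mxE.
rewrite -!mulr_sumr -!natr_sum ler_wpM2l// ler_nat.
exact: sum_nbh_le.
Qed.

(** A plan transporting [x] to itself along the edges uses up the whole demand,
    as supply and demand have the same total; both marginals of the plan are then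
    [x], and so is the mean of the two marginals, which is the required
    combination of edges. *)
Lemma weight_le_cone (x : 'rV[R]_q) :
  (forall i, 0 <= x ord0 i) ->
  (forall S : {set 'I_q}, weight x S <= weight x (nbh V S)) -> cone R V x.
Proof.
move=> x0 xS.
pose E : {set 'I_q * 'I_q} := [set p | `[< adj V p.1 p.2 >]]%SET.
have tE S : targets E S = nbh V S.
  apply/setP => j; apply/targetsP/idP.
    move=> [i iS]; rewrite inE/= => /asboolP ij.
    exact: adj_nbh (adjC ij) iS.
  rewrite inE => /asboolP[i iS ji]; exists i => //.
  by rewrite inE/=; apply/asboolP/adjC.
have [w [w0 wE wa wb]] : transportable E (fun i => x ord0 i) (fun i => x ord0 i).
  by apply: hall_transportable => // S; rewrite tE; exact: xS.
have wb' j : \sum_i w i j = x ord0 j.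
  have sw : \sum_j (x ord0 j - \sum_i w i j) = 0.
    rewrite sumrB [X in _ - X]exchange_big/=.
    by under [X in _ - X]eq_bigr do rewrite wa; rewrite subrr.
  have := psumr_eq0P _ sw; move=> /(_ _ j isT)/eqP.
  by rewrite subr_eq0 => h; apply/esym/eqP/h => i _; rewrite subr_ge0.
exists #|E|, (fun k : 'I_#|E| => unit_vec (enum_val k).1 + unit_vec (enum_val k).2),
  (fun k : 'I_#|E| => w (enum_val k).1 (enum_val k).2 / 2); split.
  move=> k; split; last by rewrite divr_ge0.
  by have := enum_valP k; rewrite inE => /asboolP.
rewrite -(big_enum_val (fun p : 'I_q * 'I_q => (w p.1 p.2 / 2) *:
   map_mx (fun m : nat => m%:R) (unit_vec p.1 + unit_vec p.2))).
apply/rowP => l; rewrite summxE big_mkcond/=.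
(* Coordinate [l] is half the sum of the two marginals of [w] at [l]. *)
transitivity (\sum_(p : 'I_q * 'I_q) (w p.1 p.2 * (l == p.1)%:R / 2
                                    + w p.1 p.2 * (l == p.2)%:R / 2)).
  rewrite big_split/= -(pair_big xpredT xpredT (fun i j => w i j * (l == i)%:R / 2))/=.
  rewrite -(pair_big xpredT xpredT (fun i j => w i j * (l == j)%:R / 2))/=.
  rewrite (bigD1 l)//= [X in _ + X + _]big1 ?addr0; last first.
    by move=> i il; rewrite big1// => j _; rewrite eq_sym (negbTE il) mulr0 mul0r.
  rewrite [X in _ + X]exchange_big/= [X in _ + X](bigD1 l)//=.
  rewrite [X in _ + (_ + X)]big1 ?addr0; last first.
    by move=> i il; rewrite big1// => j _; rewrite eq_sym (negbTE il) mulr0 mul0r.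
  rewrite eqxx -!mulr_suml.
  by rewrite !mulr1 wa wb' -splitr.
apply: eq_bigr => -[i j] _ /=; case: ifPn => [ij|/wE ->]; last by rewrite !mul0r addr0.
by rewrite !mxE eqxx/= natrD mulrDr !(mulrAC _ _ 2^-1); case: eqP; case: eqP.
Qed.

Lemma ball_coord (x y : 'rV[R]_q) (e : R) :
  ball x e y <-> 0 < e /\ forall i, `|x ord0 i - y ord0 i| < e.
Proof.
split.
  case=> e0 h; split=> // i; exact: h.
by move=> [e0 h]; split=> // i j; rewrite (ord1 i); exact: h.
Qed.

(** If [N(S)] contained [S], it would do so strictly and weigh more, since the
    weights are positive.  So some [i] in [S] lies outside [N(S)], and any increase
    of [lam_i] makes [S] deficient. *)
Lemma critical_boundary (lam : 'rV[R]_q) :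
  (forall i, 0 < lam ord0 i) ->
  ~ (exists S : {set 'I_q}, deficient V lam S) ->
  (exists S : {set 'I_q}, critical V lam S) ->
  boundary (cone R V) lam.
Proof.
move=> lam0 ndef [S [S0 wS nS]]; split.
  apply: subset_closure; apply: weight_le_cone => [i|T]; first exact: ltW.
  have [->|T0] := eqVneq T finset.set0.
    by rewrite /weight big_set0 sumr_ge0// => i _; apply: ltW.
  by rewrite leNgt; apply/negP => dT; apply: ndef; exists T.
have [i iS inS] : exists2 i, i \in S & i \notin nbh V S.
  apply/fintype.subsetPn; apply/negP => sub; apply: nS; apply/eqP; rewrite finset.eqEsubset sub/=.
  apply/fintype.subsetP => j jN; apply/negPn/negP => jS; move/eqP: wS.
  rewrite /weight (big_setID S)/= (finset.setIidPr sub) eq_sym.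
  rewrite -subr_eq0 opprD addrA subrr add0r oppr_eq0.
  rewrite psumr_eq0; last by move=> ? _; apply: ltW.
  move=> /allP/(_ j); rewrite mem_index_enum inE jN jS/= => /(_ isT).
  by rewrite gt_eqF.
move=> /nbhs_ballP[e /= e0 he].
have /he /(cone_weight_le S) : ball lam e (lam + (e / 2) *: delta_mx 0 i).
  apply/ball_coord; split=> // j; rewrite !mxE eqxx/=.
  rewrite opprD addrA subrr add0r normrN ger0_norm ?mulr_ge0 ?divr_ge0 ?ler0n// ?ltW//.
  case: (j == i); rewrite ?mulr1 ?mulr0//.
  by rewrite ltr_pdivrMr// ltr_pMr// ltr1n.
move=> /le_gtF/negbT/negP; apply; rewrite /weight.
have sumd (T : {set 'I_q}) : \sum_(k in T) (lam + (e / 2) *: delta_mx 0 i) ord0 k =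
    weight lam T + (if i \in T then e / 2 else 0).
  rewrite -sum_point -big_split/=; apply: eq_bigr => k _; rewrite !mxE eqxx/=.
  by congr (_ + _); case: eqP => _; rewrite ?mulr1 ?mulr0.
by rewrite !sumd iS (negbTE inS) wS ltrD2l divr_gt0.
Qed.

Lemma weight_continuous (S : {set 'I_q}) :
  continuous (fun x : 'rV[R]_q => weight x S).
Proof.
rewrite (_ : (fun _ => _) = \sum_(i in S) (fun x : 'rV[R]_q => x ord0 i)); last first.
  by apply/funext => x; rewrite /weight fct_sumE.
elim/big_rec: _ => [|i f _ cf] x; first exact: (@cst_continuous _ _ (0 : R)).
by apply: continuousD; [exact: coord_continuous|exact: cf].
Qed.

(** Near [lam] the finitely many inequalities that are strict at [lam] persist,
    and the others are identities. *)
Lemma excessive_interior (lam : 'rV[R]_q) :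
  (forall i, 0 < lam ord0 i) ->
  (forall S : {set 'I_q}, S != finset.set0 -> excessive V lam S \/ nbh V S = S) ->
  interior (cone R V) lam.
Proof.
move=> lam0 hS; rewrite /interior/=.
have near0 : \forall x \near lam, forall i : 'I_q, 0 <= (x : 'rV[R]_q) ord0 i.
  apply: (@filter_forall _ _ (fun i (x : 'rV[R]_q) => 0 <= x ord0 i) (nbhs lam) _) => i.
  have : \forall x \near lam, 0 < (x : 'rV[R]_q) ord0 i.
    have c : (fun x : 'rV[R]_q => x ord0 i) @ lam --> lam ord0 i.
      exact: coord_continuous.
    exact: (cvgr_gt _ c).
  by apply: filterS => x /ltW.
have nearS : \forall x \near lam, forall S : {set 'I_q}, weight x S <= weight x (nbh V S).
  apply: (@filter_forall _ _ (fun S (x : 'rV[R]_q) => weight x S <= weight x (nbh V S))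
    (nbhs lam) _) => S.
  have [->|S0] := eqVneq S finset.set0.
    apply: filterS near0 => x x0.
    by rewrite {1}/weight big_set0 sumr_ge0.
  case: (hS _ S0) => [[_ eS]|->]; last exact: nearW.
  have c : (fun x : 'rV[R]_q => weight x (nbh V S) - weight x S) @ lam -->
      weight lam (nbh V S) - weight lam S.
    exact: cvgB (@weight_continuous _ lam) (@weight_continuous _ lam).
  have : \forall x \near lam, 0 < weight x (nbh V S) - weight x S.
    by apply: (cvgr_gt _ c); rewrite subr_gt0.
  by apply: filterS => x; rewrite subr_gt0 => /ltW.
by apply: filterS2 near0 nearS => x; exact: weight_le_cone.
Qed.

End ConeGraph.

(** * Counting points and blocks of a matching *)

Section Counting.
Variable R : realType.
Local Open Scope card_scope.
Local Open Scope ereal_scope.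

Lemma counting_ge0 (T : choiceType) (A : set T) : 0 <= counting A :> \bar R.
Proof. by rewrite /counting; case: ifP => // _; rewrite lee_fin. Qed.

Lemma counting_finite (T : choiceType) (A : set T) : finite_set A ->
  counting A = (#|` fset_set A|)%:R%:E :> \bar R.
Proof. by move=> fA; rewrite /counting asboolT. Qed.

Lemma counting_II (T : choiceType) (A : set T) n : A #= `I_n ->
  counting A = n%:R%:E :> \bar R.
Proof.
move=> An; rewrite counting_finite ?(card_fset_set An)//.
by apply/finite_setP; exists n.
Qed.

Lemma counting_card_le (T U : choiceType) (A : set T) (B : set U) : A #<= B ->
  counting A <= counting B :> \bar R.
Proof.
move=> AB; have [fB|iB] := pselect (finite_set B); last first.
  by rewrite [leRHS]/counting asboolF// leey.
have /finite_setP[n Bn] := fB.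
have An : A #<= `I_n by apply: card_le_trans AB _; move: Bn; rewrite card_eq_le => /andP[].
have fA : finite_set A by apply/finite_set_leP; exists n.
rewrite (counting_II Bn) counting_finite// lee_fin ler_nat.
exact: geq_card_fset_set.
Qed.

Lemma counting_card_eq (T U : choiceType) (A : set T) (B : set U) : A #= B ->
  counting A = counting B :> \bar R.
Proof.
rewrite card_eq_le => /andP[AB BA].
by apply/eqP; rewrite eq_le !counting_card_le.
Qed.

Lemma le_counting (T : choiceType) (A B : set T) : A `<=` B ->
  counting A <= counting B :> \bar R.
Proof. by move=> AB; apply/counting_card_le/subset_card_le. Qed.

Lemma counting0 (T : choiceType) : counting (@set0 T) = 0 :> \bar R.
Proof. by rewrite counting_finite// fset_set0. Qed.

Lemma counting_setU (T : choiceType) (A B : set T) :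
  counting (A `|` B) <= counting A + counting B :> \bar R.
Proof.
have [fA|iA] := pselect (finite_set A); last first.
  by rewrite [counting A]/counting asboolF// addye ?leey// -ltNye (lt_le_trans _ (counting_ge0 _)).
have [fB|iB] := pselect (finite_set B); last first.
  by rewrite [counting B]/counting asboolF// addey ?leey// -ltNye (lt_le_trans _ (counting_ge0 _)).
rewrite !counting_finite ?finite_setU// -EFinD lee_fin -natrD ler_nat fset_setU//.
by rewrite cardfsU leq_subr.
Qed.

Lemma counting_bigcup (T : choiceType) (J : finType) (A : J -> set T) :
  counting (\bigcup_j A j) <= \sum_j counting (A j) :> \bar R.
Proof.
apply: (@le_trans _ _ (counting (\big[setU/set0]_j A j))).
  by apply: le_counting => x [j _ Ax]; rewrite (bigD1 j)//=; left.
elim/big_rec2: _ => [|j y B _ By]; first by rewrite counting0.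
by apply: le_trans (counting_setU _ _) _; rewrite leeD2l.
Qed.

End Counting.

Section Blocks.
Variable T : choiceType.
Implicit Types (A B : set T) (M : set {fset T}).

(** For [A] inside [B], only these blocks spoil a comparison of the number of
    points in [A] with the number of points in [B]. *)
Definition crossing A B : set {fset T} :=
  [set F | [set` F] `&` A !=set0 /\ ~ [set` F] `<=` B].

Definition meeting A : set {fset T} := [set F | [set` F] `&` A !=set0].

Lemma crossing_meeting A B : crossing A B `<=` meeting A.
Proof. by move=> F []. Qed.

(** The map from a point to its block sends the points in [A] onto the blocks
    meeting [A]. *)
Lemma counting_meeting (R : realType) q (X : 'I_q -> set T) M A :
  partition M (fun F : {fset T} => [set` F]) (\bigcup_i X i) ->
  (counting (M `&` meeting A) <= \sum_i counting (X i `&` A) :> \bar R)%E.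
Proof.
move=> [cov triv _].
apply: le_trans (counting_bigcup _ _); apply: counting_card_le.
pose block x := xget fset0 [set F : {fset T} | M F /\ x \in F].
apply: card_le_trans (card_image_le block _); apply: subset_card_le.
move=> F [MF [x [xF xA]]].
have [i _ Xx] : (\bigcup_i X i) x by rewrite -cov; exists F.
exists x; first by exists i.
have [MG xG] : [set F : {fset T} | M F /\ x \in F] (block x).
  by apply: (@xgetPex _ fset0 [set F : {fset T} | M F /\ x \in F]); exists F.
by apply: triv => //; exists x.
Qed.

Variables (q : nat) (V : set 'rV[nat]_q) (X : 'I_q -> set T).
Hypothesis V2 : forall v, V v -> (\sum_(i < q) v ord0 i)%N = 2%N.

(** Count the points of [A] block by block.  A block inside [B] has no more points
    in [S] than in [N(S)], and all of them lie in [B]; a block leaving [B] has at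
    most two points.  A point is counted once for each class that it belongs to,
    as are the points in the type of a block, so that the classes may overlap. *)
Lemma counting_matched (R : realType) M A B (S : {set 'I_q}) :
  partition M (fun F : {fset T} => [set` F]) (\bigcup_i X i) ->
  (forall F, M F -> exists2 v, V v & forall i, [set` F] `&` X i #= `I_(v ord0 i))%card ->
  A `<=` B -> (forall i, finite_set (X i `&` B)) ->
  (\sum_(i in S) counting (X i `&` A) <=
   \sum_(i in nbh V S) counting (X i `&` B) +
   2%:R%:E * counting (M `&` crossing A B) :> \bar R)%E.
Proof.
move=> part typ AB finB; have [cov triv _] := part.
have finA i : finite_set (X i `&` A).
  by apply: sub_finite_set (finB i) => x [Xx Ax]; split=> //; exact: AB.
have finM : finite_set (M `&` meeting A).
  apply: contrapT => infM; have := counting_meeting R A part.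
  rewrite {1}/counting asboolF// leye_eq => /eqP.
  under eq_bigr do rewrite counting_finite//.
  by rewrite sumEFin.
have finC : finite_set (M `&` crossing A B).
  by apply: sub_finite_set finM => F [MF /crossing_meeting].
rewrite (counting_finite _ finC).
under eq_bigr do rewrite counting_finite//.
under [in leRHS]eq_bigr do rewrite counting_finite//.
rewrite !sumEFin -EFinM -EFinD lee_fin -!natr_sum -natrM -natrD ler_nat.
pose XA i := fset_set (X i `&` A); pose XB i := fset_set (X i `&` B).
pose MA := fset_set (M `&` meeting A).
have inXA i x : (x \in XA i) = (x \in X i `&` A) by rewrite in_fset_set.
have inXB i x : (x \in XB i) = (x \in X i `&` B) by rewrite in_fset_set.
have inMA F : (F \in MA) = (F \in M `&` meeting A) by rewrite in_fset_set.
have cardI (K : {fset T}) F : #|` K `&` F|%fset = (\sum_(x <- K) (x \in F))%N.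
  rewrite card_fset_sum1 (_ : (K `&` F)%fset = [fset x in K | x \in F]%fset); last first.
    by apply/fsetP => x; rewrite !inE.
  by rewrite big_fset/= big_mkcond/=; apply: eq_bigr => x _; case: ifP.
have leXA i : (#|` XA i| <= \sum_(F <- MA) #|` XA i `&` F|%fset)%N.
  under [leqRHS]eq_bigr do rewrite cardI.
  rewrite exchange_big/= card_fset_sum1 !big_seq; apply: leq_sum => x.
  rewrite inXA inE => -[Xx Ax].
  have [F MF xF] : (cover M (fun F : {fset T} => [set` F])) x.
    by rewrite cov; exists i.
  have FMA : F \in MA by rewrite inMA inE; split=> //; exists x.
  by rewrite (big_fsetD1 F)//= (_ : x \in F).
pose inB (F : {fset T}) := `[< [set` F] `<=` B >].
have geXB i : (\sum_(F <- MA | inB F) #|` XB i `&` F|%fset <= #|` XB i|)%N.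
  under eq_bigr do rewrite cardI.
  rewrite exchange_big/= card_fset_sum1 !big_seq; apply: leq_sum => x _.
  have [[F [FMA xF]]|noF] := pselect (exists F, F \in MA /\ x \in F); last first.
    rewrite big_seq_cond big1// => F /andP[FMA _]; apply/eqP; rewrite eqb0.
    by apply/negP => xF; apply: noF; exists F.
  rewrite big_mkcond (big_fsetD1 F)//= big_seq big1 ?addn0.
    by case: ifP => // _; exact: leq_b1.
  move=> G; rewrite in_fsetD1 => /andP[GF GMA]; case: ifP => // _; apply/eqP; rewrite eqb0.
  apply/negP => xG; move/eqP: GF; apply; apply: triv; last by exists x.
    by move: GMA; rewrite inMA inE => -[].
  by move: FMA; rewrite inMA inE => -[].
have cardC : #|` fset_set (M `&` crossing A B)| = (\sum_(F <- MA) ~~ inB F)%N.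
  rewrite card_fset_sum1 (_ : fset_set _ = [fset F in MA | ~~ inB F]%fset).
    by rewrite big_fset/= big_mkcond/=; apply: eq_bigr => F _; case: ifP.
  apply/fsetP => F; rewrite in_fset_set// !inE/= inMA.
  apply/idP/idP; rewrite !inE/=.
    by move=> [MF [mF nF]]; apply/andP; split; [rewrite inE|apply/asboolPn].
  by move=> /andP[]; rewrite inE => -[MF mF] /asboolPn nF.
apply: (@leq_trans (\sum_(i in S) \sum_(F <- MA) #|` XA i `&` F|%fset)%N).
  by apply: leq_sum => i _; exact: leXA.
rewrite exchange_big/= cardC big_distrr/=.
apply: (@leq_trans (\sum_(F <- MA) ((if inB F then
   \sum_(i in nbh V S) #|` XB i `&` F|%fset else 0) + 2 * ~~ inB F))%N); last first.
  rewrite big_split/= leq_add2r -big_mkcond/= exchange_big/=.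
  by apply: leq_sum => i _; exact: geXB.
rewrite !big_seq; apply: leq_sum => F; rewrite inMA inE => -[MF mF].
have [v Vv vF] := typ _ MF.
have leXAv i : (#|` XA i `&` F|%fset <= v ord0 i)%N.
  rewrite -(card_fset_set (vF i)); apply: fsubset_leq_card; apply/fsubsetP => x.
  rewrite !inE inXA in_fset_set; last by apply/finite_setP; exists (v ord0 i).
  move=> /andP[/set_mem[Xx Ax] xF]; exact/mem_set.
rewrite /inB; case: asboolP => FB /=.
  rewrite muln0 addn0.
  apply: (@leq_trans (\sum_(i in S) v ord0 i)%N).
    by apply: leq_sum => i _; exact: leXAv.
  apply: leq_trans (sum_nbh_le V2 S Vv) _.
  apply: leq_sum => i _; rewrite -(card_fset_set (vF i)); apply: fsubset_leq_card.
  apply/fsubsetP => x; rewrite !inE inXB in_fset_set; last by apply/finite_setP; exists (v ord0 i).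
  move=> /set_mem[xF Xx]; apply/andP; split=> //; apply/mem_set; split=> //; exact: FB.
rewrite muln1 add0n -(V2 Vv); apply: (@leq_trans (\sum_(i in S) v ord0 i)%N).
  by apply: leq_sum => i _; exact: leXAv.
by rewrite [leqRHS](bigID (mem S))/= leq_addr.
Qed.

End Blocks.

(** * Random numbers of points and their means *)

Section Events.
Variables (R : realType) (T : choiceType) (G : set_system T).

(** The number of points in [B] takes countably many values, each on an event of
    the generating system. *)
Lemma config_events_counting B (Y : set \bar R) : G B ->
  config_events G [set X | Y (counting (X `&` B))].
Proof.
move=> GB; have [E0 EC EU] := smallest_sigma_algebra setT
  [set C | exists2 B, G B & exists n : nat, C = [set X : set T | X `&` B #= `I_n]%card].
have Ecard n : config_events G [set X : set T | X `&` B #= `I_n]%card.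
  by apply: sub_sigma_algebra; exists B => //; exists n.
have Efin : config_events G [set X : set T | finite_set (X `&` B)].
  rewrite (_ : [set X | _] = \bigcup_n [set X : set T | X `&` B #= `I_n]%card).
    exact (EU _ Ecard).
  by apply/seteqP; split => X /=; rewrite finite_setP => -[n]; [exists n|move=> _ ?; exists n].
(* Index [0] stands for the infinite configurations, [m.+1] for those with [m]
   points. *)
pose part n : set (set T) :=
  if n is m.+1 then [set X : set T | Y m%:R%:E /\ (X `&` B #= `I_m)%card]
  else [set X : set T | Y +oo%E /\ ~ finite_set (X `&` B)].
have mpart n : config_events G (part n).
  case: n => [|n].
    have [Yoo|nYoo] := pselect (Y +oo%E).
      have -> : part 0%N = setT `\` [set X : set T | finite_set (X `&` B)].
        by apply/seteqP; split => X /= [].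
      exact (EC _ Efin).
    have -> : part 0%N = set0 by apply/seteqP; split => X // [].
    exact E0.
  have [Yn|nYn] := pselect (Y n%:R%:E).
    have -> : part n.+1 = [set X : set T | X `&` B #= `I_n]%card.
      by apply/seteqP; split => X /= => [[]|].
    exact (Ecard n).
  have -> : part n.+1 = set0 by apply/seteqP; split => X // [].
  exact E0.
have -> : [set X | Y (counting (X `&` B))] = \bigcup_n part n; last exact (EU _ mpart).
apply/seteqP; split => X /=.
  have [fX|iX] := pselect (finite_set (X `&` B)).
    have /finite_setP[n Xn] := fX; rewrite (counting_II _ Xn) => YX.
    by exists n.+1.
  by rewrite /counting asboolF// => YX; exists 0%N.
move=> [[|n] _ /= [YX Xn]]; last by rewrite (counting_II _ Xn).
by rewrite /counting asboolF.
Qed.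

Variables (K : set_system T) (disp : measure_display) (Omega : measurableType disp).

Definition occupancy (X : Omega -> set T) B (w : Omega) : \bar R :=
  counting (X w `&` B).

Lemma measurable_occupancy (X : Omega -> set T) B :
  simple_point_process G K X -> G B ->
  measurable_fun setT (occupancy X B).
Proof.
move=> [_ mX] GB _ Y mY; rewrite setTI.
exact: (mX _ (config_events_counting Y GB)).
Qed.

End Events.
Arguments occupancy R {T disp Omega}.

(** The mean depends on the law only: it is an integral over the pushforward. *)
Lemma eq_law_integral (R : realType) (disp : measure_display)
    (Omega : measurableType disp) (P : probability Omega R) (f g : Omega -> \bar R) :
  measurable_fun setT f -> measurable_fun setT g ->
  (forall w, 0 <= f w)%E -> (forall w, 0 <= g w)%E ->
  (forall Y, measurable Y -> P (f @^-1` Y) = P (g @^-1` Y)) ->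
  (\int[P]_w f w = \int[P]_w g w)%E.
Proof.
move=> mf mg f0 g0 fg.
have push (h : Omega -> \bar R) : measurable_fun setT h -> (forall w, 0 <= h w)%E ->
    (\int[P]_w h w = \int[pushforward P h]_y `|y|)%E.
  move=> mh h0; rewrite ge0_integral_pushforward//.
  by apply: eq_integral => w _ /=; rewrite gee0_abs.
rewrite (push f)// (push g)//; apply: eq_measure_integral => Y mY _.
exact: fg.
Qed.

Section PoissonMean.
Variable R : realType.

(** [k r^k / k! = r r^(k-1) / (k-1)!], so the series is [r e^-r] times the
    exponential series, shifted by one. *)
Lemma poisson_mean (r : R) :
  (\sum_(0 <= k <oo) (k%:R * poisson_weight r k)%:E = r%:E)%E.
Proof.
apply/cvg_lim => //; rewrite -(cvg_shiftS _ (nbhs (r%:E))).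
rewrite (_ : (fun n => _) = EFin \o (fun n => expR (- r) * r * series (exp_coeff r) n)).
  apply: cvg_EFin; first exact: nearW.
  have lim : expR (- r) * r * series (exp_coeff r) n @[n --> \oo] -->
      expR (- r) * r * expR r.
    by apply: cvgMr; exact: is_cvg_series_exp_coeff.
  by move: lim; rewrite [X in _ --> X -> _]mulrAC -expRD addNr expR0 mul1r.
apply/funext => n /=; rewrite sumEFin; congr EFin.
rewrite big_nat_recl// mul0r add0r /series/= mulr_sumr.
apply: eq_bigr => k _; rewrite /poisson_weight /exp_coeff/= factS natrM exprS.
have k0 : k.+1%:R != 0 :> R by rewrite pnatr_eq0.
rewrite invfM; move: (k.+1%:R) k0 => c c0.
rewrite -[RHS]mul1r -(mulfV c0) !mulrA; congr (_ * _).
by rewrite !(mulrAC _ _ c^-1).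
Qed.

End PoissonMean.

(** * Cubes and translations *)

Section Mean.
Variables (R : realType) (d : nat).
Variables (disp : measure_display) (Omega : measurableType disp).
Variable P : probability Omega R.
Local Open Scope ereal_scope.

Lemma poisson_process_mean (lam : R) (X : Omega -> set 'rV[R]_d) B :
  poisson_process P lam X -> borel B -> bounded_set B ->
  \int[P]_w occupancy R X B w = (lam * fine (volume B))%:E.
Proof.
move=> [[finX mX] lawX] bB bdB.
pose A n : set Omega := [set w | X w `&` B #= `I_n]%card.
have mA n : measurable (A n).
  by apply: (mX [set Y | Y `&` B #= `I_n]%card); apply: sub_sigma_algebra; exists B => //; exists n.
have PA n : P (A n) = (poisson_weight (lam * fine (volume B)) n)%:E.
  have := lawX 1%N (fun=> B) (fun=> n) (fun=> conj bB bdB).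
  rewrite big_ord1 => <-.
    congr (P _); apply/seteqP; split => w /=; first by move=> Aw j.
    by move=> /(_ ord0).
  by move=> i j _ _ _; rewrite !ord1.
have series w : occupancy R X B w = \sum_(0 <= n <oo) n%:R%:E * (\1_(A n) w)%:E.
  have /finite_setP[m Am] := finX w _ bdB.
  rewrite /occupancy (counting_II _ Am).
  rewrite (nneseriesD1 (n := m))//.
  rewrite eseries0 ?adde0; last first.
    move=> k _ /= km; rewrite indicE memNset ?mule0//= => Ak.
    move/eqP: km; apply; apply/card_eq_II; apply: card_eq_trans Am.
    by rewrite card_eq_sym.
  by rewrite indicE mem_set// mule1.
under eq_integral do rewrite series.
rewrite integral_nneseries//.
- rewrite -[RHS]poisson_mean; apply: eq_eseriesr => n _.
  rewrite ge0_integralZl//; first by rewrite integral_indic// setIT [X in _ * X]PA.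
  by apply/measurable_EFinP; exact: measurable_indic.
- move=> n; apply: emeasurable_funM; first exact: measurable_cst.
  by apply/measurable_EFinP; exact: measurable_indic.
Qed.

End Mean.

Section Cubes.
Variable R : realType.

Definition cube d (a b : R) : set 'rV[R]_d := [set x | forall i, a <= x ord0 i <= b].

Lemma volume0 d : volume (@set0 'rV[R]_d) = 0%E.
Proof.
elim: d => [|d IH]; first by rewrite /= indic0.
by rewrite /= integral0_eq// => x _; exact: IH.
Qed.

(** The section of a cube at [x] is the cube of one dimension less, or empty. *)
Lemma volume_cube d (a b : R) : a <= b ->
  volume (cube (d := d) a b) = ((b - a) ^+ d)%:E.
Proof.
move=> ab; elim: d => [|d IH].
  by rewrite /= indicE mem_set// => -[].
rewrite /=.
have section x : [set y : 'rV[R]_d | @cube d.+1 a b (row_mx (x%:M : 'rV_1) y)] =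
    if x \in `[a, b] then cube a b else set0.
  pose in_section y := forall i : 'I_(1 + d),
    a <= (row_mx (x%:M : 'rV_1) y : 'rV_(1 + d)) ord0 i <= b.
  case: ifPn; rewrite in_itv/= => xab; apply/seteqP; split => y //.
  - by move=> h0 i; have h : in_section y := h0; have := h (rshift 1 i); rewrite row_mxEr.
  - move=> h; suff : in_section y by [].
    move=> i; rewrite -(splitK i); case: (fintype.split i) => j /=.
      by rewrite row_mxEl (ord1 j) mxE.
    by rewrite row_mxEr.
  - move=> h0; have h : in_section y := h0.
    by have := h (lshift d ord0); rewrite row_mxEl mxE/= mulr1n (negbTE xab).
transitivity (\int[@lebesgue_measure R]_x (((b - a) ^+ d)%:E * (\1_`[a, b]%classic x)%:E))%E.
  apply: eq_integral => x _; rewrite section indicE mem_setE.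
  by case: ifP => _; rewrite ?IH ?volume0 ?mule1 ?mule0.
rewrite ge0_integralZl//.
- rewrite integral_indic// setIT.
  rewrite [X in (_ * X)%E](lebesgue_measure_itv `[a, b])/= lte_fin.
  case: ltP => [_|ba]; first by rewrite -EFinD -EFinM exprSr.
  have -> : a = b by apply/eqP; rewrite eq_le ab.
  by rewrite subrr exprS mul0r mule0.
- by apply/measurable_EFinP; exact: measurable_indic.
- by rewrite lee_fin exprn_ge0// subr_ge0.
Qed.

Lemma closed_cube d (a b : R) : closed (cube (d := d) a b).
Proof.
have -> : cube a b = \bigcap_(i in setT) ((fun x : 'rV[R]_d => x ord0 i) @^-1` `[a, b]%classic).
  apply/seteqP; split => x /= h i; first by move=> _; rewrite /= in_itv/=; exact: h.
  by have := h i Logic.I; rewrite /= in_itv.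
apply: closed_bigI => i _; apply: preimage_closed; last exact: itv_closed.
by move=> x _; exact: coord_continuous.
Qed.

Lemma borel_closed d (A : set 'rV[R]_d) : closed A -> borel A.
Proof.
move=> cA; have [_ EC _] := smallest_sigma_algebra setT (@open 'rV[R]_d).
rewrite -(setCK A) -setTD; apply: EC.
by apply: sub_sigma_algebra; exact: closed_openC.
Qed.

Lemma bounded_cube d (a b : R) : bounded_set (cube (d := d) a b).
Proof.
exists (`|a| + `|b|); split; first by rewrite num_real.
move=> M hM x hx; apply: le_trans (ltW hM).
rewrite [leLHS]/Num.Def.normr/= mx_normrE; apply/bigmax_leP; split=> [|[i j] _ /=].
  by rewrite addr_ge0.
rewrite (ord1 i); have /andP[ax xb] := hx j.
have [x0|x0] := ger0P (x ord0 j).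
  by rewrite (le_trans xb)// (le_trans (ler_norm b))// lerDr.
by rewrite (@le_trans _ _ `|a|)// ?lerDl// -normrN (le_trans _ (ler_norm _))// lerN2.
Qed.

End Cubes.

Section Shift.
Variables (R : realType) (q d : nat).
Implicit Types (A B : set 'rV[R]_d) (t : 'rV[R]_d).

Definition unshift t A : set 'rV[R]_d := [set x | A (x + t)].

(** A block crosses from [A] to outside [B] when neither its number of points in
    [A] nor that in the complement of [B] vanishes. *)
Lemma fset_events_crossing A B : borel A -> borel B -> fset_events (crossing A B).
Proof.
move=> bA bB; have [E0 EC EU] := smallest_sigma_algebra setT
  [set C | exists2 B, @borel R d B &
     exists n : nat, C = [set X : set 'rV[R]_d | X `&` B #= `I_n]%card].
have [_ bC _] := smallest_sigma_algebra setT (@open 'rV[R]_d).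
pose empty D := [set X : set 'rV[R]_d | X `&` D #= `I_0]%card.
have eE D : borel D -> config_events (@borel R d) (empty D).
  by move=> bD; apply: sub_sigma_algebra; exists D => //; exists 0%N.
exists (setT `\` (empty A `|` empty (setT `\` B))).
  apply: (EC (empty A `|` empty (setT `\` B))); rewrite -bigcup2E.
  apply: EU => -[|[|n]] /=; [exact: eE|apply: eE; exact: bC|exact E0].
rewrite setTI; apply/seteqP; split => F /=; rewrite /empty/= II0 !card_eq0.
  move=> [_ /not_orP[FA FB]]; split; first exact/set0P/negP.
  by move=> sub; apply: FB; apply/eqP/seteqP; split => x // -[xF []] _; apply; exact: sub.
move=> [FA FB]; split=> //; case; first by move/eqP => F0; move: FA; rewrite F0 => -[].
move/eqP => F0; apply: FB => x xF; apply: contrapT => nB.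
by have : set0 x by rewrite -F0.
Qed.

Lemma counting_fset_shift t (M : set {fset 'rV[R]_d}) A B :
  counting (fset_shift t M `&` crossing A B) =
  counting (M `&` crossing (unshift t A) (unshift t B)) :> \bar R.
Proof.
pose sh (F : {fset 'rV[R]_d}) := [fset (x + t)%R | x in F]%fset.
have shE F x : (x + t \in sh F) = (x \in F).
  apply/imfsetP/idP => [[y yF /addIr ->//]|xF]; by exists x.
have sh_inj : injective sh.
  by move=> F G FG; apply/fsetP => x; rewrite -(shE F) -(shE G) FG.
rewrite (_ : fset_shift t M `&` _ = sh @` (M `&` crossing (unshift t A) (unshift t B))).
  by apply: counting_card_eq; apply: inj_card_eq; exact: in2W.
apply/seteqP; split=> F.
- move=> [[G MG <-] [[_ [/imfsetP[x xG ->] xA]] nB]].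
  exists G => //; split=> //; split; first by exists x.
  by move=> sub; apply: nB => _ /imfsetP[y yG ->]; exact: sub.
- move=> [G [MG [[x [xG xA]] nB]] <-]; split; first by exists G.
  split; first by exists (x + t); split=> //; rewrite /= shE.
  by move=> sub; apply: nB => y yG; apply: sub; rewrite /= shE.
Qed.

Variables (disp : measure_display) (Omega : measurableType disp).
Variable P : probability Omega R.

(** The blocks of the translated matching that cross from [A] out of [B] are the
    translates of those that cross between the translated sets. *)
Lemma mean_crossing_shift (Pi : 'I_q -> Omega -> set 'rV[R]_d)
    (M : Omega -> set {fset 'rV[R]_d}) t A B :
  simple_point_process (@fset_events R d) (@fset_bounded R d) M ->
  translation_invariant P Pi M -> 
  borel A -> borel B ->
  borel (unshift t A) -> borel (unshift t B) ->
  (\int[P]_w occupancy R M (crossing A B) w =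
   \int[P]_w occupancy R M (crossing (unshift t A) (unshift t B)) w)%E.
Proof.
move=> sppM inv bA bB bA' bB'; apply: eq_law_integral.
- by apply: measurable_occupancy sppM _; exact: fset_events_crossing.
- by apply: measurable_occupancy sppM _; exact: fset_events_crossing.
- by move=> w; exact: counting_ge0.
- by move=> w; exact: counting_ge0.
move=> Y mY; pose C := [set X : set {fset 'rV[R]_d} | Y (counting (X `&` crossing A B))].
have mC : config_events (@fset_events R d) C.
  by apply: config_events_counting; exact: fset_events_crossing.
have := inv t [set c | C c.1] _.
rewrite /C/= => <-; last first.
  by apply: sub_sigma_algebra; left; exists C.
by congr (P _); apply/seteqP; split => w /=; rewrite counting_fset_shift.
Qed.

End Shift.

(** * Invariant matchings of Poisson processes *)

Section Tiling.
Variables (R : realType) (d : nat).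

Definition tile m (f : {ffun 'I_d -> 'I_m}) : 'rV[R]_d := \row_i (f i)%:R.

Lemma closed_unshift (t : 'rV[R]_d) A : closed A -> closed (unshift t A).
Proof.
move=> cA; apply: (preimage_closed (f := fun x : 'rV[R]_d => x + t)) => // x _.
by apply: continuousD; [exact: cvg_id|exact: cst_continuous].
Qed.

(** The unit cubes [z + [0,1]^d] with [z] in [{0, ..., m}^d] cover [[0,m]^d], and
    the enlargement of each by [r] lies in [[-r, m+1+r]^d].  Closed cubes are used,
    which overlap and include [z_i = m], as only an upper bound is needed. *)
Lemma crossing_tile (m r : nat) :
  crossing (@cube R d 0 m%:R) (cube (- r%:R) (m%:R + 1 + r%:R)) `<=`
  \bigcup_(f : {ffun 'I_d -> 'I_m.+1})
    crossing (unshift (- tile f) (cube 0 1)) (unshift (- tile f) (cube (- r%:R) (1 + r%:R))).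
Proof.
move=> F [[x [xF xm]] nF].
have lt_m i : (Num.truncn (x ord0 i) < m.+1)%N.
  have /andP[x0 x1] := xm i; rewrite truncn_lt_nat//.
  by apply: le_lt_trans x1 _; rewrite ltr_nat.
exists [ffun i => Ordinal (lt_m i)] => //; split.
  exists x; split=> // i; rewrite !mxE ffunE/=.
  have /andP[x0 _] := xm i; have /andP[tx xt] := truncn_itv x0.
  rewrite subr_ge0 tx/= lerBlDr; apply/ltW/(lt_le_trans xt).
  by rewrite -natr1 addrC.
move=> sub; apply: nF => y yF i; have := sub y yF i; rewrite !mxE ffunE/=.
have t0 : 0 <= (Num.truncn (x ord0 i))%:R :> R by [].
have tm : (Num.truncn (x ord0 i))%:R <= m%:R :> R by rewrite ler_nat -ltnS.
by move=> /andP[h1 h2]; apply/andP; split; lra.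
Qed.

End Tiling.

Section NoMatching.
Variables (R : realType) (q d : nat) (V : set 'rV[nat]_q) (lam : 'rV[R]_q).
Hypothesis V2 : forall v, V v -> (\sum_(i < q) v ord0 i)%N = 2%N.
Variables (disp : measure_display) (Omega : measurableType disp).
Variables (P : probability Omega R) (Pi : 'I_q -> Omega -> set 'rV[R]_d).
Hypothesis poissonPi : forall i, poisson_process P (lam ord0 i) (Pi i).
Variable M : Omega -> set {fset 'rV[R]_d}.
Hypothesis matchM : matching_scheme P V Pi M.
Hypothesis invM : translation_invariant P Pi M.

Let points i B := occupancy R (Pi i) B.

(** The mean of this number is what the blocks cut by the boundary of a large
    cube cost per unit cube. *)
Let long_blocks (r : nat) :=
  occupancy R M (crossing (cube 0 1) (cube (- r%:R) (1 + r%:R))).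

Let borel_cube (a b : R) : borel (@cube R d a b).
Proof. by apply: borel_closed; exact: closed_cube. Qed.

Let borel_tile t (a b : R) : borel (unshift t (@cube R d a b)).
Proof. by apply: borel_closed; apply: closed_unshift; exact: closed_cube. Qed.

Let m_points i a b : measurable_fun setT (points i (cube a b)).
Proof. by apply: (measurable_occupancy (poissonPi i).1); exact: borel_cube. Qed.

Let m_crossing A B : closed A -> closed B ->
  measurable_fun setT (occupancy R M (crossing A B)).
Proof.
move=> cA cB; apply: (measurable_occupancy matchM.1).
by apply: fset_events_crossing; exact: borel_closed.
Qed.

Lemma integral_sum_in (I : finType) (S : {set I}) (f : I -> Omega -> \bar R) :
  (forall i, measurable_fun setT (f i)) -> (forall i w, 0 <= f i w)%E ->
  (\int[P]_w (\sum_(i in S) f i w) = \sum_(i in S) \int[P]_w f i w)%E.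
Proof.
move=> mf f0; under eq_integral do rewrite -big_enum.
by rewrite ge0_integral_sum// big_enum.
Qed.

Let measurable_sum_in (I : finType) (S : {set I}) (f : I -> Omega -> \bar R) :
  (forall i, measurable_fun setT (f i)) ->
  measurable_fun setT (fun w => \sum_(i in S) f i w)%E.
Proof.
move=> mf; under eq_fun do rewrite -big_enum; exact: emeasurable_sum.
Qed.

Lemma mean_points i (a b : R) : a <= b ->
  (\int[P]_w points i (cube a b) w = (lam ord0 i * (b - a) ^+ d)%:E)%E.
Proof.
move=> ab; rewrite (poisson_process_mean (poissonPi i)) ?volume_cube//.
exact: bounded_cube.
Qed.

Lemma mean_points_in (S : {set 'I_q}) (a b : R) : a <= b ->
  (\int[P]_w (\sum_(i in S) points i (cube a b) w) = (weight lam S * (b - a) ^+ d)%:E)%E.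
Proof.
move=> ab; rewrite integral_sum_in//; last by move=> i w; exact: counting_ge0.
under eq_bigr do rewrite mean_points//.
by rewrite sumEFin mulr_suml.
Qed.

(** By invariance every tile sees as many long blocks as the unit cube. *)
Lemma mean_long_blocks_tile m r (f : {ffun 'I_d -> 'I_m}) :
  (\int[P]_w occupancy R M (crossing (unshift (- tile R f) (cube 0 1))
      (unshift (- tile R f) (cube (- r%:R) (1 + r%:R)))) w = \int[P]_w long_blocks r w)%E.
Proof.
have uK (A : set 'rV[R]_d) : unshift (tile R f) (unshift (- tile R f) A) = A.
  by apply/seteqP; split => x; rewrite /unshift/= addrK.
rewrite (mean_crossing_shift (t := tile R f) matchM.1 invM) ?uK//.
Qed.

(** The mean of [counting_matched] for the cube [[0,m]^d] and its enlargement,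
    with the crossing blocks charged to the unit cubes which they meet. *)
Lemma weight_volume_le (S : {set 'I_q}) (m r : nat) :
  ((weight lam S * m%:R ^+ d)%:E <=
   (weight lam (nbh V S) * (m%:R + 1 + 2 * r%:R) ^+ d)%:E +
   2%:R%:E * ((m.+1%:R ^+ d)%:E * \int[P]_w long_blocks r w))%E.
Proof.
pose far (f : {ffun 'I_d -> 'I_m.+1}) := occupancy R M
  (crossing (unshift (- tile R f) (cube 0 1)) (unshift (- tile R f) (cube (- r%:R) (1 + r%:R)))).
have m_far f : measurable_fun setT (far f).
  by apply: m_crossing; apply: closed_unshift; exact: closed_cube.
have far0 f w : (0 <= far f w)%E by exact: counting_ge0.
have -> : ((m.+1%:R ^+ d)%:E * \int[P]_w long_blocks r w)%E =
    (\int[P]_w \sum_(f in [set: {ffun 'I_d -> 'I_m.+1}]%SET) far f w)%E.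
  rewrite integral_sum_in//; under eq_bigr do rewrite mean_long_blocks_tile.
  have natmulE (x : \bar R) n : GRing.natmul x n = (n%:R%:E * x)%E.
    by rewrite mule_natl; elim: n => // n IH; rewrite mulrS muleS IH.
  by rewrite sumr_const cardsT card_ffun !card_ord natmulE natrX.
have -> : (weight lam S * m%:R ^+ d)%:E = (\int[P]_w (\sum_(i in S) points i (cube 0 m%:R) w))%E.
  by rewrite mean_points_in// subr0.
have -> : (weight lam (nbh V S) * (m%:R + 1 + 2 * r%:R) ^+ d)%:E =
    (\int[P]_w (\sum_(i in nbh V S) points i (cube (- r%:R) (m%:R + 1 + r%:R)) w))%E.
  rewrite mean_points_in; last by have : 0 <= r%:R :> R by []; have : 0 <= m%:R :> R by []; lra.
  by congr (_ * _ ^+ _)%:E; lra.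
have sum_ge0 (I : finType) (T : {set I}) (f : I -> \bar R) :
    (forall i, 0 <= f i)%E -> (0 <= \sum_(i in T) f i)%E.
  by move=> f0; apply: sume_ge0.
have p0 i B w : (0 <= points i B w)%E by exact: counting_ge0.
have m_pts (T : {set 'I_q}) a b :
    measurable_fun setT (fun w => \sum_(i in T) points i (cube a b) w)%E.
  by apply: measurable_sum_in => i; exact: m_points.
have m_tiles : measurable_fun setT
    (fun w => \sum_(f in [set: {ffun 'I_d -> 'I_m.+1}]%SET) far f w)%E.
  exact: measurable_sum_in.
have m_twice : measurable_fun setT
    (fun w => 2%:R%:E * \sum_(f in [set: {ffun 'I_d -> 'I_m.+1}]%SET) far f w)%E.
  by apply: emeasurable_funM => //; exact: measurable_cst.
rewrite -ge0_integralZl//; last by move=> w _; exact: sum_ge0.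
rewrite -ge0_integralD//; first last.
- by move=> w _; rewrite mule_ge0// sum_ge0.
- by move=> w _; exact: sum_ge0.
apply: ae_ge0_le_integral => //.
- by move=> w _; exact: sum_ge0.
- by move=> w _; rewrite adde_ge0 ?mule_ge0// sum_ge0.
- exact: emeasurable_funD.
have := matchM.2; apply: filterS => w [part typ] _.
have r0 : 0 <= r%:R :> R by [].
apply: le_trans (counting_matched V2 R S part typ (A := cube 0 m%:R)
  (B := cube (- r%:R) (m%:R + 1 + r%:R)) _ _) _.
- by move=> x xm i; have /andP[x0 x1] := xm i; apply/andP; split; lra.
- by move=> i; apply: (poissonPi i).1.1; exact: bounded_cube.
rewrite leeD2l// lee_pmul2l//.
apply: le_trans (le_counting R (B := \bigcup_f (M w `&` crossing (unshift (- tile R f) (cube 0 1))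
   (unshift (- tile R f) (cube (- r%:R) (1 + r%:R))))) _) _.
  move=> F [MF /crossing_tile[f _ Ff]]; by exists f.
apply: le_trans (counting_bigcup _ _) _.
by under [leRHS]eq_bigl do rewrite inE.
Qed.

Lemma cube_exhaust (F : {fset 'rV[R]_d}) :
  \forall r \near \oo, [set` F] `<=` cube (- r%:R) (1 + r%:R).
Proof.
apply: filterS (@filter_bigI _ _ F (fun x : 'rV[R]_d =>
  [set r : nat | cube (- r%:R) (1 + r%:R) x]) \oo _ _) => [r h x xF|x _].
  exact: h.
apply: (@filter_forall _ _ (fun i (r : nat) => - r%:R <= x ord0 i <= 1 + r%:R) \oo _) => i.
apply: filterS (nbhs_infty_ger `|x ord0 i|) => r /=.
rewrite ler_norml => /andP[h1 h2]; apply/andP; split; lra.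
Qed.

(** Almost surely finitely many blocks meet the unit cube and each is bounded, so
    that eventually none is long; their number is dominated by the number of
    points in the unit cube, which has finite mean. *)
Lemma mean_long_blocks_cvg0 : (\int[P]_w long_blocks r w @[r --> \oo] --> 0)%E.
Proof.
pose g w := (\sum_i points i (cube 0 1) w)%E.
have g0 w : (0 <= g w)%E by apply: sume_ge0 => i _; exact: counting_ge0.
have mg : measurable_fun setT g by apply: emeasurable_sum => i; exact: m_points.
have ig : P.-integrable setT g.
  apply/integrableP; split => //.
  under eq_integral do rewrite gee0_abs//.
  rewrite /g ge0_integral_sum//; last by move=> i w _; exact: counting_ge0.
  under eq_bigr do rewrite mean_points//.
  by rewrite sumEFin ltry.
have pointwise : {ae P, forall w, setT w -> long_blocks ^~ w @ \oo --> 0%E}.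
  apply: filterS matchM.2 => w [part _] _; apply: cvg_near_cst.
    have fin : finite_set (M w `&` meeting (cube 0 1)).
      apply: contrapT => inf; have := counting_meeting R (cube 0 1) part.
      rewrite {1}/counting asboolF// leye_eq => /eqP.
      under eq_bigr do rewrite (counting_finite _ ((poissonPi _).1.1 w _ (@bounded_cube R d 0 1))).
      by rewrite sumEFin.
    apply: filterS (@filter_bigI _ _ (fset_set (M w `&` meeting (cube 0 1)))
      (fun F : {fset 'rV[R]_d} => [set r : nat | [set` F] `<=` cube (- r%:R) (1 + r%:R)]) \oo _ _).
      move=> r h; rewrite /long_blocks /occupancy (_ : _ `&` _ = set0) ?counting0//.
      apply/seteqP; split => // F [MF [mF nF]]; apply: nF; apply: h.
      by rewrite /= in_fset_set// inE; split.
    by move=> F _; exact: cube_exhaust.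
have dominated : {ae P, forall w r, setT w -> `|long_blocks r w| <= g w}%E.
  apply: filterS matchM.2 => w [part _] r _; rewrite gee0_abs ?counting_ge0//.
    apply: le_trans (counting_meeting R (cube 0 1) part).
    by apply: le_counting => F [MF /crossing_meeting].
have [_ _] := dominated_convergence measurableT
  (fun r => m_crossing (@closed_cube R d _ _) (@closed_cube R d _ _))
  (measurable_cst _) pointwise ig dominated.
by rewrite integral0.
Qed.

(** Divide [weight_volume_le] by the volume [m^d], let the cube grow at fixed [r],
    then let [r] grow. *)
Lemma matching_weight_le (S : {set 'I_q}) : weight lam S <= weight lam (nbh V S).
Proof.
have [fin cvg0] := (fine_cvgP _ _).1 mean_long_blocks_cvg0.
pose c r := fine (\int[P]_w long_blocks r w)%E.
set LS := weight lam S; set LN := weight lam (nbh V S).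
have step r : (\int[P]_w long_blocks r w)%E \is a fin_num -> LS <= LN + 2 * c r.
  move=> finr.
  (* For [m = n.+1] the quotient by [m^d] is a polynomial in [1 / n.+1]. *)
  have ineq n : LS <= LN * (1 + (1 + 2 * r%:R) * harmonic n) ^+ d
      + 2 * ((1 + harmonic n) ^+ d * c r).
    have := weight_volume_le S n.+1 r; rewrite -(fineK finr) -!EFinM -EFinD lee_fin -/(c r).
    pose h : R := harmonic n; have h0 : 0 <= h by rewrite invr_ge0.
    have eA : n.+1%:R * h = 1 by rewrite mulfV// pnatr_eq0.
    have eB : (n.+1%:R + 1 + 2 * r%:R) * h = 1 + (1 + 2 * r%:R) * h.
      by rewrite -addrA mulrDl eA.
    have eC : n.+2%:R * h = 1 + h by rewrite -natr1 mulrDl eA mul1r.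
    move=> /(ler_wpM2r (exprn_ge0 d h0)).
    rewrite mulrDl -mulrA -exprMn eA expr1n mulr1 => /le_trans; apply.
    by rewrite -!mulrA -exprMn eB [c r * _]mulrC [_ ^+ d * (_ ^+ d * _)]mulrA -exprMn eC.
  have lim0 (k : R) : (1 + k * harmonic n) ^+ d @[n --> \oo] --> (1 : R).
    have : 1 + k * harmonic n @[n --> \oo] --> 1 + k * 0.
      by apply: cvgD; [exact: cvg_cst|apply: cvgMr; exact: cvg_harmonic].
    rewrite mulr0 addr0 => h.
    have := cvg_comp _ _ h (@exprn_continuous R d 1); by rewrite expr1n.
  apply: (cvgr_to_ge (f := fun n => LN * (1 + (1 + 2 * r%:R) * harmonic n) ^+ d
      + 2 * ((1 + harmonic n) ^+ d * c r)) (F := \oo)); last exact: nearW.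
  rewrite -[X in _ --> LN + 2 * X]mul1r -[X in _ --> X + _]mulr1.
  apply: cvgD; first by apply: cvgMr; exact: lim0.
  apply: cvgMr; apply: cvgMl.
  by under eq_fun do rewrite -[harmonic _]mul1r; exact: lim0.
apply: (cvgr_to_ge (f := fun r => LN + 2 * c r) (F := \oo)).
  rewrite -[X in _ --> X]addr0 -(mulr0 2).
  by apply: cvgD; [exact: cvg_cst|apply: cvgMr; exact: cvg0].
by apply: filterS fin => r; exact: step.
Qed.

End NoMatching.

Theorem proposition4 (R : realType) (q : nat) (V : set 'rV[nat]_q)
    (lam : 'rV[R]_q)
    (hq : (1 <= q)%N)
    (hV : forall v, V v -> (\sum_(i < q) v ord0 i)%N = 2%N)
    (hlam : forall i, 0 < lam ord0 i) :
  [/\ (exists S : {set 'I_q}, deficient V lam S) ->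
        ~ cone R V lam /\
        forall (d : nat) (hd : (1 <= d)%N)
          (disp : measure_display) (Omega : measurableType disp)
          (P : probability Omega R) (Pi : 'I_q -> Omega -> set 'rV[R]_d),
          independent_poisson P lam Pi ->
          ~ exists M : Omega -> set {fset 'rV[R]_d},
              matching_scheme P V Pi M /\ translation_invariant P Pi M,
      ~ (exists S : {set 'I_q}, deficient V lam S) ->
        (exists S : {set 'I_q}, critical V lam S) ->
        boundary (cone R V) lam
    & (forall S : {set 'I_q}, S != finset.set0 ->
         excessive V lam S \/ nbh V S = S) ->
        interior (cone R V) lam ].
Proof.
split.
- move=> [S [S0 defS]]; split; first by move=> /(cone_weight_le hV S)/le_gtF/negP; apply.
  move=> d _ disp Omega P Pi [poissonPi _] [M [matchM invM]].
  have := matching_weight_le hV poissonPi matchM invM S.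
  by rewrite leNgt defS.
- exact: critical_boundary.
- exact: excessive_interior.
Qed.
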